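(* Let $\hat f:\mathbb{R}^n\times\mathbb{R}^n\to\mathbb{R}^n$ be polynomial and let $c>0$. Let $\tau(x)$ be the inter-execution time, implicitly defined by the execution rule $|\mathrm{e}|=c|\mathrm{x}|$, of the system $$\dot{\mathrm{x}}=\hat f(\mathrm{x},\mathrm{e}),\qquad \dot{\mathrm{e}}=-\hat f(\mathrm{x},\mathrm{e})$$ for a point $x\in\mathbb{R}^n$, and let $\tilde\tau(x,w)$ be the inter-execution time, under the same execution rule $|\mathrm{e}|=c|\mathrm{x}|$, of the homogenized system $$\dot{\mathrm{x}}=\tilde f(\mathrm{x},\mathrm{w},\mathrm{e},\mathrm{e}_w),\quad \dot{\mathrm{w}}=0,\quad \dot{\mathrm{e}}=-\tilde f(\mathrm{x},\mathrm{w},\mathrm{e},\mathrm{e}_w),\quad \dot{\mathrm{e}}_w=0$$ for a point $(x,w)\in\mathbb{R}^{n+1}$. Then, for every $x\in\mathbb{R}^n$, $$\tau(x)=\lambda^{l-1}\,\tilde\tau(\lambda x,\lambda)\qquad\text{for all }\lambda>0,$$ where $l$ is the highest degree of the monomials of $\hat f$.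
   Context: $|\cdot|$ is the Euclidean norm. Here $\dot{\mathrm{x}}=\hat f(\mathrm{x},\mathrm{e})=f(\mathrm{x},k(\mathrm{x}+\mathrm{e}))$ is a closed-loop control system under a sampled feedback law with measurement error $\mathrm{e}$ (last sampled state minus current state, so $\mathrm{e}=0$ at sampling instants). Write, for $i=1,\dots,n$, $$\hat f_i(x,e)=\sum_{j=1}^p\alpha_{ij}\,x_1^{r_{1_{ij}}}\cdots x_n^{r_{n_{ij}}}e_1^{s_{1_{ij}}}\cdots e_n^{s_{n_{ij}}},\qquad p\in\mathbb{N}_{\ge1},\ r_{k_{ij}},s_{k_{ij}}\in\mathbb{N}_0,$$ and set $m_{ij}=\sum_{k=1}^n(r_{k_{ij}}+s_{k_{ij}})$ and $l=\max_{i,j}m_{ij}$. The homogenization $\tilde f$ has components $$\tilde f_i(x,w,e,e_w)=\sum_{j=1}^p\alpha_{ij}\,x_1^{r_{1_{ij}}}\cdots x_n^{r_{n_{ij}}}\,w^{\,l-m_{ij}}\,e_1^{s_{1_{ij}}}\cdots e_n^{s_{n_{ij}}}$$ (with no dependence on the dummy error variable $e_w\in\mathbb{R}$), so that $\tilde f(x,1,e,0)=\hat f(x,e)$. $\tau(x)$ is the first time $t\ge0$ at which $|\mathrm{e}(t)|=c|\mathrm{x}(t)|$ along the solution with initial condition $(\mathrm{x}(0),\mathrm{e}(0))=(x,0)$. $\tilde\tau(x,w)$ is the first time $t\ge0$ at which $|\mathrm{e}(t)|=c|\mathrm{x}(t)|$ (only the $\mathrm{x}$ and $\mathrm{e}$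 components, not $\mathrm{w}$ and $\mathrm{e}_w$) along the solution of the homogenized system with initial condition $(\mathrm{x}(0),\mathrm{w}(0),\mathrm{e}(0),\mathrm{e}_w(0))=(x,w,0,0)$. The value is $+\infty$ if there is no such time. *)

(* Defs.v *)
From HB Require Import structures.
From mathcomp Require Import all_boot all_order all_algebra.
From mathcomp Require Import all_classical all_reals all_analysis.

Set Implicit Arguments.
Unset Strict Implicit.
Unset Printing Implicit Defensive.

Import Order.TTheory GRing.Theory Num.Theory.
Import numFieldNormedType.Exports.

Local Open Scope classical_set_scope.
Local Open Scope ring_scope.

(* The norm that the library puts on 'rV[R]_n is the sup norm. *)
Definition enorm (R : realType) (n : nat) (v : 'rV[R]_n) : R :=
  Num.sqrt (\sum_(i < n) v 0 i ^+ 2).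

(* A polynomial vector field of (x, e) is given by the coefficients
   [alpha i j] of the p monomials of each component i, and by the exponents
   [r i j k] of x_k and [s i j k] of e_k.  Coefficients may vanish, so that all
   components can be written with the same number p of monomials. *)
Section PolynomialField.
Variables (R : realType) (n p : nat).
Variables (alpha : 'I_n -> 'I_p -> R) (r s : 'I_n -> 'I_p -> 'I_n -> nat).

Definition poly_field (x e : 'rV[R]_n) : 'rV[R]_n :=
  \row_i \sum_(j < p) alpha i j *
    (\prod_(k < n) x 0 k ^+ r i j k) * (\prod_(k < n) e 0 k ^+ s i j k).

Definition monomial_degree (i : 'I_n) (j : 'I_p) : nat :=
  (\sum_(k < n) (r i j k + s i j k))%N.

Definition max_degree : nat :=
  (\max_(i < n) \max_(j < p) monomial_degree i j)%N.

Definition homogenization (x : 'rV[R]_n) (w : R) (e : 'rV[R]_n) (ew : R) :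
    'rV[R]_n :=
  \row_i \sum_(j < p) alpha i j *
    (\prod_(k < n) x 0 k ^+ r i j k) * w ^+ (max_degree - monomial_degree i j)
    * (\prod_(k < n) e 0 k ^+ s i j k).

End PolynomialField.

(* u' = v on [0, T[, one-sided at 0: when v is continuous on [0, T[, the
   continuity of u there and the equation on ]0, T[ yield the right derivative
   of u at 0 by the mean value theorem. *)
Definition evolves (R : realType) (V : normedModType R) (T : R)
    (u v : R -> V) : Prop :=
  {within `[0, T[, continuous u} /\
  forall t : R, 0 < t < T -> is_derive t 1 u (v t).

Definition closed_loop_solution (R : realType) (n : nat)
    (f : 'rV[R]_n -> 'rV[R]_n -> 'rV[R]_n) (x0 : 'rV[R]_n) (T : R)
    (x e : R -> 'rV[R]_n) : Prop :=
  [/\ x 0 = x0, e 0 = 0,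
      evolves T x (fun t => f (x t) (e t)) &
      evolves T e (fun t => - f (x t) (e t))].

Definition homogenized_solution (R : realType) (n : nat)
    (g : 'rV[R]_n -> R -> 'rV[R]_n -> R -> 'rV[R]_n)
    (x0 : 'rV[R]_n) (w0 : R) (T : R)
    (x : R -> 'rV[R]_n) (w : R -> R) (e : R -> 'rV[R]_n) (ew : R -> R) : Prop :=
  [/\ x 0 = x0, w 0 = w0, e 0 = 0 & ew 0 = 0] /\
  [/\ evolves T x (fun t => g (x t) (w t) (e t) (ew t)),
      evolves T (V := R^o) w (fun=> 0),
      evolves T e (fun t => - g (x t) (w t) (e t) (ew t)) &
      evolves T (V := R^o) ew (fun=> 0)].

(* Inter-execution times.  For a locally Lipschitz (e.g. polynomial) field two
   solutions with the same initial condition agree on their common domain, and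
   the maximal solution is defined at time t iff some solution on [0, T[ with
   t < T exists.  Hence the set below is the set of times at which |e| = c |x|
   along the maximal solution.  By continuity this set is closed in the
   interval of existence, so its infimum is its least element when it is
   nonempty; it is +oo when it is empty (in particular when the solution blows
   up before the rule is met). *)
Definition inter_execution_time (R : realType) (n : nat)
    (f : 'rV[R]_n -> 'rV[R]_n -> 'rV[R]_n) (c : R) (x0 : 'rV[R]_n) : \bar R :=
  ereal_inf [set t%:E | t in [set t : R | 0 <= t /\
    exists (T : R) (x e : R -> 'rV[R]_n),
      [/\ closed_loop_solution f x0 T x e, t < T &
          enorm (e t) = c * enorm (x t)]]].

Definition homogenized_inter_execution_time (R : realType) (n : nat)
    (g : 'rV[R]_n -> R -> 'rV[R]_n -> R -> 'rV[R]_n) (c : R)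
    (x0 : 'rV[R]_n) (w0 : R) : \bar R :=
  ereal_inf [set t%:E | t in [set t : R | 0 <= t /\
    exists (T : R) (x : R -> 'rV[R]_n) (w : R -> R)
           (e : R -> 'rV[R]_n) (ew : R -> R),
      [/\ homogenized_solution g x0 w0 T x w e ew, t < T &
          enorm (e t) = c * enorm (x t)]]].

(* Main.v *)
(* If (x, e) solves the original system, then t |-> (lambda x(mu t), lambda,
   lambda e(mu t), 0) with mu = lambda^(l-1) solves the homogenized one, because
   the homogenization is homogeneous of degree l = (l - 1) + 1 and coincides with
   the original field at w = 1; conversely w is constant along homogenized
   solutions, so that all those starting at (lambda x, lambda) are of this form.
   The rule |e| = c |x| is invariant under the scaling by lambda, so the two sets
   of triggering times are proportional with ratio mu. *)
Require Import Defs.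
From HB Require Import structures.
From mathcomp Require Import all_boot all_order all_algebra.
From mathcomp Require Import all_classical all_reals all_analysis.
From mathcomp Require Import ring.

Set Implicit Arguments.
Unset Strict Implicit.
Unset Printing Implicit Defensive.

Import Order.TTheory GRing.Theory Num.Theory.
Import numFieldNormedType.Exports.

Local Open Scope classical_set_scope.
Local Open Scope ring_scope.

(** Chain rule: the inner map has derivative [mu], and the differential of [u] is linear, so [mu]
    comes out as a scalar. *)
Lemma is_derive_rescale (R : realType) (V : normedModType R) (u : R -> V)
    (d : V) (a mu t : R) :
  is_derive (mu * t) 1 u d ->
  is_derive t 1 (fun t => a *: u (mu * t)) ((a * mu) *: d).
Proof.
move=> [du <-].
have du' : differentiable u (mu * t) by exact/derivable1_diffP.
have dm : differentiable ( *%R mu) t by [].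
have dum : differentiable (u \o *%R mu) t by exact: differentiable_comp.
have H : is_derive t 1 (u \o *%R mu) (mu *: 'D_1 u (mu * t)).
  apply: DeriveDef; first exact/derivable1_diffP.
  rewrite !deriveE// diff_comp//= -linearZ/=; congr ('d u _ _).
  rewrite -deriveE//.
  exact: @derive_val _ _ _ _ _ _ _ (is_deriveZ mu (is_derive_id t (1 : R))).
by rewrite -scalerA; exact: (is_deriveZ a H).
Qed.

(** Multiplication by [mu] maps [[0, T / mu[] into [[0, T[]. The relation between [v'] and [v] is
    asked only on the open interval, where the differential equation is imposed. *)
Lemma evolves_rescale (R : realType) (V : normedModType R) (T : R)
    (u v v' : R -> V) (a mu : R) :
  0 < mu -> evolves T u v ->
  (forall t, 0 < t < T / mu -> v' t = (a * mu) *: v (mu * t)) ->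
  evolves (T / mu) (fun t => a *: u (mu * t)) v'.
Proof.
move=> mu0 [cu du] vE; split.
  apply/subspace_continuousP => t /=; rewrite in_itv/= => /andP[t0 tT].
  apply: cvgZr.
  have mut : `[0, T[%classic (mu * t).
    by rewrite /= in_itv/= mulr_ge0 ?(ltW mu0)//= mulrC -ltr_pdivlMr.
  move/subspace_continuousP : cu => /(_ _ mut); apply: cvg_comp.
  (* Convergence within [[0, T[] is pulled back along [t |-> mu * t], which respects the two
     domains. *)
  move=> A; rewrite /within/= => nA.
  have cm : (fun t => mu * t) s @[s --> t] --> mu * t by exact: mulrl_continuous.
  have := cm _ nA; rewrite /= !nbhs_simpl/=; apply: filterS => s sA.
  rewrite in_itv/= => /andP[s0 sT]; apply: sA.
  by rewrite in_itv/= mulr_ge0 ?(ltW mu0)//= mulrC -ltr_pdivlMr.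
move=> t tT; rewrite vE//; apply/is_derive_rescale/du.
by case/andP: tT => t0 tT; rewrite mulr_gt0//= mulrC -ltr_pdivlMr.
Qed.

Lemma evolves_cst (R : realType) (V : normedModType R) (T : R) (a : V) :
  evolves T (fun=> a) (fun=> 0).
Proof.
split=> [|t _]; last exact: is_derive_cst.
by apply: continuous_subspaceT => t; exact: cvg_cst.
Qed.

(** Mean value theorem on [[0, t]], which lies inside [[0, T[] because [t < T]. *)
Lemma evolves0_cst (R : realType) (T : R) (w : R -> R) :
  evolves T (V := R^o) w (fun=> 0) -> forall t, 0 <= t < T -> w t = w 0.
Proof.
move=> [cw dw] t /andP[t0 tT].
have [s st||c _] := @MVT_segment R w (fun=> 0) _ _ t0.
- by apply: dw; move: st; rewrite in_itv/= => /andP[-> /lt_trans ->].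
- apply: continuous_subspaceW cw => s /=.
  by rewrite !in_itv/= => /andP[-> /le_lt_trans ->].
by rewrite mul0r => /eqP; rewrite subr_eq0 => /eqP.
Qed.

Lemma enormZ (R : realType) (n : nat) (a : R) (v : 'rV[R]_n) :
  enorm (a *: v) = `|a| * enorm v.
Proof.
rewrite /enorm -sqrtr_sqr -sqrtrM ?sqr_ge0// mulr_sumr; congr Num.sqrt.
by apply: eq_bigr => i _; rewrite mxE exprMn.
Qed.

Section Homogeneity.
Variables (R : realType) (n p : nat).
Variables (alpha : 'I_n -> 'I_p -> R) (r s : 'I_n -> 'I_p -> 'I_n -> nat).

Lemma monomial_degree_max i j :
  (monomial_degree r s i j <= max_degree r s)%N.
Proof.
apply: leq_trans (leq_bigmax (F := fun i => \max_(j < p) _)%N i).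
exact: leq_bigmax.
Qed.

(** The power of [w] brings every monomial to the same total degree. [ew] and [ew'] are unrelated
    because the field does not depend on this variable. *)
Lemma homogenizationZ (a w ew ew' : R) (x e : 'rV[R]_n) :
  homogenization alpha r s (a *: x) (a * w) (a *: e) ew =
  a ^+ max_degree r s *: homogenization alpha r s x w e ew'.
Proof.
apply/rowP => i; rewrite !mxE mulr_sumr; apply: eq_bigr => j _.
have prodZ (y : 'rV[R]_n) (q : 'I_n -> nat) :
    \prod_k (a *: y) 0 k ^+ q k = a ^+ (\sum_k q k) * \prod_k y 0 k ^+ q k.
  rewrite -prodrXr -big_split/=; apply: eq_bigr => k _.
  by rewrite mxE exprMn.
rewrite !prodZ exprMn.
(* The natural-number subtraction is exact here, as no monomial exceeds the maximal degree. *)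
have -> : a ^+ max_degree r s = a ^+ (max_degree r s - monomial_degree r s i j)
    * (a ^+ (\sum_k r i j k) * a ^+ (\sum_k s i j k)).
  by rewrite -!exprD -big_split/= subnK// monomial_degree_max.
ring.
Qed.

Lemma homogenization1 (ew : R) (x e : 'rV[R]_n) :
  homogenization alpha r s x 1 e ew = poly_field alpha r s x e.
Proof.
by apply/rowP => i; rewrite !mxE; apply: eq_bigr => j _; rewrite expr1n mulr1.
Qed.

Lemma homogenization_scaled (a ew : R) (x e : 'rV[R]_n) :
  homogenization alpha r s (a *: x) a (a *: e) ew =
  a ^+ max_degree r s *: poly_field alpha r s x e.
Proof. by rewrite -(homogenization1 ew) -(homogenizationZ _ _ ew) mulr1. Qed.

Section Solutions.
Variables (lambda : R) (x0 : 'rV[R]_n) (T : R).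
Hypothesis lambda_gt0 : 0 < lambda.
(** An integer power, since the exponent is -1 when the maximal degree is 0. *)
Let mu : R := lambda ^ ((max_degree r s)%:Z - 1).

Let mu_gt0 : 0 < mu. Proof. exact: exprz_gt0. Qed.

(** Matches the factor from the chain rule with the one from homogeneity. *)
Let lambda_mu : lambda * mu = lambda ^+ max_degree r s.
Proof. by rewrite -{1}[lambda]expr1z -expfzDr ?gt_eqF// addrC subrK. Qed.

Lemma homogenized_solution_rescale (x e : R -> 'rV[R]_n) :
  closed_loop_solution (poly_field alpha r s) x0 T x e ->
  homogenized_solution (homogenization alpha r s) (lambda *: x0) lambda (T / mu)
    (fun t => lambda *: x (mu * t)) (fun=> lambda)
    (fun t => lambda *: e (mu * t)) (fun=> 0).
Proof.
move=> [xE eE dx de]; split; first by split; rewrite ?mulr0 ?xE ?eE ?scaler0.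
split; try exact: evolves_cst.
- apply: (evolves_rescale mu_gt0 dx) => t _.
  by rewrite homogenization_scaled lambda_mu.
- apply: (evolves_rescale mu_gt0 de) => t _.
  by rewrite homogenization_scaled lambda_mu scalerN.
Qed.

(** The inverse scaling, with factors [lambda^-1] and [mu^-1]; it returns to the original field
    because [w] stays equal to [lambda]. *)
Lemma closed_loop_solution_rescale (x e : R -> 'rV[R]_n) (w ew : R -> R) :
  homogenized_solution (homogenization alpha r s) (lambda *: x0) lambda T
    x w e ew ->
  closed_loop_solution (poly_field alpha r s) x0 (T / mu^-1)
    (fun t => lambda^-1 *: x (mu^-1 * t)) (fun t => lambda^-1 *: e (mu^-1 * t)).
Proof.
move=> [[xE wE eE _] [dx dw de _]].
have lambda_neq0 : lambda != 0 by rewrite gt_eqF.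
have muV_gt0 : 0 < mu^-1 by rewrite invr_gt0.
have fieldE t : 0 < t < T / mu^-1 -> let t' := mu^-1 * t in
    poly_field alpha r s (lambda^-1 *: x t') (lambda^-1 *: e t') =
    (lambda^-1 * mu^-1) *: homogenization alpha r s (x t') (w t') (e t') (ew t').
  move=> /andP[t0 tT] t'; rewrite (evolves0_cst dw) ?wE; last first.
    apply/andP; split; first by rewrite mulr_ge0// ltW.
    by rewrite /t' mulrC -ltr_pdivlMr.
  rewrite -invfM lambda_mu.
  (* Writing both states as [lambda] times their rescaled versions makes homogeneity applicable; the
     powers of [lambda] then cancel. *)
  rewrite -[in RHS](scalerKV lambda_neq0 (x t')).
  rewrite -[in RHS](scalerKV lambda_neq0 (e t')) homogenization_scaled.
  by rewrite scalerK// expf_neq0.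
split.
- by rewrite mulr0 xE scalerK.
- by rewrite mulr0 eE scaler0.
- exact: (evolves_rescale muV_gt0 dx).
- by apply: (evolves_rescale muV_gt0 de) => t /fieldE ->; rewrite scalerN.
Qed.

End Solutions.

End Homogeneity.

Theorem corollary5p2 (R : realType) (n p : nat) (hp : (1 <= p)%N)
    (alpha : 'I_n -> 'I_p -> R) (r s : 'I_n -> 'I_p -> 'I_n -> nat)
    (c : R) (hc : 0 < c) (x : 'rV[R]_n) (lambda : R) (hlambda : 0 < lambda) :
  inter_execution_time (poly_field alpha r s) c x =
  ((lambda ^ ((max_degree r s)%:Z - 1))%:E *
   homogenized_inter_execution_time (homogenization alpha r s) c
     (lambda *: x) lambda)%E.
Proof.
set mu := lambda ^ _.
have mu_gt0 : 0 < mu by exact: exprz_gt0.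
have ruleZ (a : R) (y e : 'rV[R]_n) :
    enorm e = c * enorm y -> enorm (a *: e) = c * enorm (a *: y).
  by move=> eyE; rewrite !enormZ eyE mulrCA.
(* As [mu > 0], it moves inside the infimum, also when the value is [+oo]; equality of the two sets
   of times remains. *)
rewrite -ereal_inf_pZl//; congr ereal_inf; apply/seteqP; split.
- move=> _ [t [t0 [T [y [e [sol tT rule]]]]] <-].
  (* The rescaled solution at time [t / mu] is [lambda] times the original one at time [t]. *)
  exists (t / mu)%:E; last by rewrite -EFinM mulrC divfK ?gt_eqF.
  exists (t / mu) => //; split; first by rewrite divr_ge0// ltW.
  exists (T / mu); do 4 eexists; split.
  + exact: homogenized_solution_rescale sol.
  + by rewrite ltr_pM2r ?invr_gt0.
  + by apply: ruleZ; rewrite [_ * (t / _)]mulrC divfK ?gt_eqF.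
- move=> _ [_ [t [t0 [T [y [w [e [ew [sol tT rule]]]]]]] <-] <-].
  exists (mu * t) => //; split; first by rewrite mulr_ge0// ltW.
  exists (T / mu^-1); do 2 eexists; split.
  + exact: closed_loop_solution_rescale sol.
  + by rewrite invrK mulrC ltr_pM2r.
  + by apply: ruleZ; rewrite mulKf ?gt_eqF.
Qed.
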